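(* Let $n,d,c\ge 1$ and $t\ge 0$ be integers such that $I=I_{c,(n,d,t)}\neq 0$. Then $I$ satisfies the strong persistence property, i.e. $(I^{s+1}:I)=I^s$ for all $s\ge 1$, and all powers of $I$ have a linear resolution.
   Context: $K$ is a field and $S=K[x_1,\dots,x_n]$. A multiset $A=\{i_1\le i_2\le\cdots\le i_d\}$ with elements in $[n]=\{1,\dots,n\}$ is $t$-spread if $i_{k+1}-i_k\ge t$ for all $k$. For a $t$-spread multiset $A$, a block of size $r$ of $A$ is a sub-multiset of consecutive elements $B=\{i_k\le i_{k+1}\le\cdots\le i_{k+r-1}\}$ with $i_{l+1}-i_l=t$ for all consecutive elements of $B$; $|B|=r$ denotes its size (counted with multiplicity). $\mathcal A_{c,(n,d,t)}$ is the set of all $t$-spread multisets $A$ in $[n]$ with $d$ elements (counted with multiplicity) such that $|B|\le c$ for every block $B\subset A$. For a multiset $A=\{i_1\le\cdots\le i_d\}$ put $\mathbf x_A=x_{i_1}\cdots x_{i_d}$. The $c$-bounded $t$-spread Veronese ideal is $I_{c,(n,d,t)}=(\mathbf x_A : A\in\mathcal A_{c,(n,d,t)})\subset S$. *)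

(* Defs.v *)
From HB Require Import structures.
From mathcomp Require Import all_boot all_order all_algebra.
From mathcomp Require Import mpoly.

Set Implicit Arguments.
Unset Strict Implicit.
Unset Printing Implicit Defensive.

Import GRing.Theory.
Local Open Scope ring_scope.

(* Ideals are Prop-valued predicates: membership in an ideal given by
   generators has no canonical boolean test here. *)

Section Ideals.
Variable R : comNzRingType.
Implicit Types I J : R -> Prop.

Definition ideal_eq I J : Prop := forall f, I f <-> J f.

Definition zero_ideal : R -> Prop := fun f => f = 0.

Definition ideal_gen (G : R -> Prop) : R -> Prop := fun f =>
  exists (m : nat) (a g : 'I_m -> R),
    (forall i, G (g i)) /\ f = \sum_(i < m) a i * g i.

Definition ideal_mul I J : R -> Prop :=
  ideal_gen (fun h => exists f g, [/\ I f, J g & h = f * g]).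

Fixpoint ideal_pow I (s : nat) : R -> Prop :=
  if s is s'.+1 then ideal_mul I (ideal_pow I s') else fun _ => True.

Definition ideal_colon I J : R -> Prop := fun f => forall g, J g -> I (f * g).

Definition strong_persistence I : Prop :=
  forall s, (1 <= s)%N ->
    ideal_eq (ideal_colon (ideal_pow I s.+1) I) (ideal_pow I s).

End Ideals.

Section Resolutions.
Variables (K : fieldType) (n : nat).
Local Notation S := {mpoly K[n]}.

(* The data of  ... -> F_2 -> F_1 -> F_0 -> S  with F_i the direct sum of the
   S(-shift i j), j < rank i.  Elements of F_i are row vectors, and maps act by
   right multiplication.  Shifts in nat suffice: the minimal generators and
   syzygies of an ideal of S live in nonnegative degrees. *)
Record free_seq := FreeSeq {
  rank : nat -> nat;
  shift : forall i, 'I_(rank i) -> nat;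
  diff : forall i, 'M[S]_(rank i.+1, rank i);
  aug : 'cV[S]_(rank 0)
}.

(* Degree-preserving maps: the (j, k) entry of diff i is homogeneous of degree
   shift i.+1 j - shift i k, hence zero when this difference is negative. *)
Definition graded (F : free_seq) : Prop :=
  (forall j, aug F j 0 \is (shift j).-homog) /\
  (forall i j k m, m \in msupp (diff F i j k) ->
     (mdeg m + @shift F i k = @shift F i.+1 j)%N).

Definition resolves (I : S -> Prop) (F : free_seq) : Prop :=
  [/\ forall f, I f <-> exists v : 'rV_(rank F 0), f = (v *m aug F) 0 0,
      forall v : 'rV_(rank F 0),
        v *m aug F = 0 <-> exists w, v = w *m diff F 0
    & forall i (v : 'rV_(rank F i.+1)),
        v *m diff F i = 0 <-> exists w, v = w *m diff F i.+1].

(* The image of F_(i+1) lies in (x_1, ..., x_n) F_i. *)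
Definition minimal (F : free_seq) : Prop :=
  forall i j k, (diff F i j k)@_0%MM = 0.

Definition has_linear_resolution (I : S -> Prop) : Prop :=
  exists F : free_seq,
    [/\ graded F, resolves I F & minimal F] /\
    exists q : nat, forall i (j : 'I_(rank F i)), shift j = (q + i)%N.

End Resolutions.

(* A multiset in [n] is represented by its nondecreasing list of elements,
   with [n] shifted to 'I_n = {0, ..., n-1}. *)

Section Veronese.
Variable n : nat.
Implicit Types A B : seq 'I_n.

Definition is_multiset A : bool := sorted (fun i j : 'I_n => (i <= j)%N) A.

Definition spread (t : nat) A : bool :=
  sorted (fun i j : 'I_n => (i + t <= j)%N) A.

Definition block (t : nat) A B : bool :=
  infix B A && sorted (fun i j : 'I_n => (i + t == j)%N) B.

Definition bounded_spread (c d t : nat) A : Prop :=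
  [/\ is_multiset A, size A = d, spread t A
    & forall B, block t A B -> (size B <= c)%N].

Definition mon (K : fieldType) A : {mpoly K[n]} := \prod_(i <- A) 'X_i.

Definition veronese_ideal (K : fieldType) (c d t : nat) : {mpoly K[n]} -> Prop :=
  ideal_gen (fun f => exists2 A, bounded_spread c d t A & f = mon K A).

End Veronese.

Arguments zero_ideal {R} f.
Arguments veronese_ideal n K c d t f : clear implicits.

(* Main.v *)
Require Import Defs.
From HB Require Import structures.
From mathcomp Require Import all_boot all_order all_algebra.
From mathcomp Require Import mpoly.
From mathcomp Require Import zify.
From Stdlib Require Import IndefiniteDescription.

Set Implicit Arguments.
Unset Strict Implicit.
Unset Printing Implicit Defensive.

Import GRing.Theory.

(** Everything is read off from partial sums. A monomial w is encoded by
    F k = w 0 + ... + w (k-1). A multiset of d elements is t-spread and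
    c-bounded exactly when every window of t consecutive indices carries at
    most 1 element and every window of c t + 1 consecutive indices carries at
    most c: in a t-spread list, c + 1 consecutive entries fitting in the larger
    window must be spaced by exactly t ([bounded_spread_capped]). Scaling these
    upper bounds and d by s gives the set [capped s].

    _Powers._ Difference constraints F b <= F a + k survive taking floors of
    F / N. Hence a monomial of [capped (s + 1)] splits off the member of
    [capped 1] with partial sums floor (F / (s + 1)), leaving a member of
    [capped s] ([capped_split]), and the s-th power of the ideal is the monomial
    ideal of [capped s] ([ideal_pow_capped]).

    _Strong persistence._ Let x^m be in the colon ideal. Multiplying by a
    generator u and splitting the result gives z + u' <= m + u with z in
    [capped s] and u' again a generator. Iterating u |-> u' on a finite set runs
    into a cycle, say of length N; along it the u cancel and the z add up to a
    member of [capped (N s)] below N m. Rounding its partial sums down after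
    division by N produces a member of [capped s] below m ([capped_colon]).

    _Linear resolutions._ In the lexicographic order the monomials of [capped s]
    have linear quotients ([capped_exchange]): if v < u, first differing at i,
    let j > i be the first index by which the partial sums of v have caught up.
    Moving one unit of v from j to i raises the partial sums of v by one only
    where they lie strictly below those of u, and before that both agree, so no
    upper bound on a window can break. To get from linear quotients to a
    resolution, the notion is extended to matrices over S: each row has, relative
    to the earlier rows, a colon ideal generated by variables. The syzygies
    expressing that X_i times row j is a combination of earlier rows generate all
    syzygies, are linear, and form a matrix with linear quotients again
    ([linear_quotients_syzygies]); iterating yields the resolution. *)

(** * Ideals generated by variables *)

Section VariableIdeals.
Local Open Scope ring_scope.
Variables (K : fieldType) (n : nat).
Local Notation S := {mpoly K[n]}.
Implicit Types (sigma : {set 'I_n}) (f g : S).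

(** Membership in the ideal (X_i : i in sigma), tested monomial by monomial;
    [var_ideal_comb] recovers the coefficients. *)
Definition in_var_ideal sigma f : Prop :=
  forall m, m \in msupp f -> exists2 i, i \in sigma & (0 < m i)%N.

Lemma var_ideal0 sigma : in_var_ideal sigma 0.
Proof. by move=> m; rewrite msupp0. Qed.

Lemma var_idealD sigma f g :
  in_var_ideal sigma f -> in_var_ideal sigma g -> in_var_ideal sigma (f + g).
Proof.
by move=> hf hg m /msuppD_le; rewrite mem_cat => /orP[/hf|/hg].
Qed.

Lemma var_idealMl sigma f g : in_var_ideal sigma f -> in_var_ideal sigma (g * f).
Proof.
move=> hf m /msuppM_le /allpairsP[[m1 m2] /= [_ /hf[i si gt0] ->]].
by exists i; rewrite // mnmDE addn_gt0 gt0 orbT.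
Qed.

Lemma var_idealX sigma i : i \in sigma -> in_var_ideal sigma 'X_i.
Proof.
by move=> si m; rewrite msuppX inE => /eqP->; exists i; rewrite // mnm1E eqxx.
Qed.

(** The ideal of a set of variables is prime and X_i lies outside it. *)
Lemma var_ideal_mulX sigma f i :
  i \notin sigma -> in_var_ideal sigma (f * 'X_i) -> in_var_ideal sigma f.
Proof.
move=> si hf m mf; have /hf[i' si'] : (U_(i) + m)%MM \in msupp (f * 'X_i).
  by rewrite (perm_mem (msuppMX _ _)) map_f.
rewrite mnmDE mnm1E; have [eq_ii'|_] := eqVneq i i'; last by exists i'.
by rewrite eq_ii' si' in si.
Qed.

Lemma var_ideal_comb sigma f :
  in_var_ideal sigma f -> exists g : 'I_n -> S, f = \sum_(i in sigma) g i * 'X_i.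
Proof.
move=> hf; rewrite [f]mpolyE big_seq.
elim/big_ind: _ => [|_ _ [g1 ->] [g2 ->]|m /hf[i si m_gt0]].
- by exists (fun=> 0); rewrite big1 // => i _; rewrite mul0r.
- exists (fun i => g1 i + g2 i); rewrite -big_split.
  by apply: eq_bigr => i _; rewrite mulrDl.
exists (fun i' => if i' == i then f@_m *: 'X_[m - U_(i)] else 0).
rewrite (bigD1 i) //= eqxx big1 => [|i' /andP[_ /negPf->]]; last by rewrite mul0r.
rewrite addr0 -scalerAl -mpolyXD submK //.
by apply/mnm_lepP => i'; rewrite mnm1E; case: eqP => // <-.
Qed.

End VariableIdeals.

(** * Extracting homogeneous coefficients *)

Section Truncation.
Local Open Scope ring_scope.
Variables (K : fieldType) (n : nat).
Local Notation S := {mpoly K[n]}.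

Lemma pihomogMr (p e : nat) (f a : S) :
  a \is e.-homog -> pihomog mdeg (p + e) (f * a) = pihomog mdeg p f * a.
Proof.
move=> ha; rewrite {1}[f]mpolyE [pihomog mdeg p f]pihomogE !mulr_suml raddf_sum /=.
rewrite [RHS]big_mkcond; apply: eq_bigr => m _.
have hm : (f@_m *: 'X_[m]) * a \is (mdeg m + e).-homog.
  by apply: dhomogM => //; apply: dhomogZ; rewrite dhomogX.
case: eqP => [<-|/eqP ne_mp]; first exact: pihomog_dE.
by rewrite (pihomog_ne0 _ hm) // eqn_add2r.
Qed.

(** A homogeneous combination of homogeneous rows may be assumed to have
    homogeneous coefficients, by discarding the other components; this is what
    makes the syzygies below linear. *)
Lemma homogeneous_comb (p e k l : nat) (A : 'M[S]_(k, l)) (c : 'rV_k) :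
    (forall i j, A i j \is e.-homog) ->
    (forall j, (c *m A) 0 j \is (p + e).-homog) ->
  c *m A = map_mx (pihomog mdeg p) c *m A.
Proof.
move=> hA hcA; apply/rowP => j; rewrite -[LHS](pihomog_dE (hcA j)) !mxE.
by rewrite raddf_sum; apply: eq_bigr => i _; rewrite [in RHS]mxE; exact: pihomogMr.
Qed.

End Truncation.

(** * Matrices with linear quotients *)

Section LinearQuotients.
Local Open Scope ring_scope.
Variables (K : fieldType) (n : nat).
Local Notation S := {mpoly K[n]}.

Definition supported_below (k : nat) (rho : 'I_k -> nat) (r : nat) (c : 'rV[S]_k) :=
  forall j, (r <= rho j)%N -> c 0 j = 0.

(** The rows, all of degree e, are ordered by the injective ranks [rho], so that
    no reindexing is needed to sort them. The last two clauses say that the rows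
    below row j have colon ideal (X_i : i in sigma j) relative to row j. *)
Definition linear_quotients (e k l : nat) (A : 'M[S]_(k, l))
    (rho : 'I_k -> nat) (sigma : 'I_k -> {set 'I_n}) : Prop :=
  [/\ forall i j, A i j \is e.-homog,
      injective rho,
      forall j i, i \in sigma j -> exists2 c : 'rV_k,
        supported_below rho (rho j) c & 'X_i *: row j A = c *m A
    & forall j f (c : 'rV_k), supported_below rho (rho j) c ->
        f *: row j A = c *m A -> in_var_ideal (sigma j) f].

Section Syzygies.
Variables (e k l : nat) (A : 'M[S]_(k, l)).
Variables (rho : 'I_k -> nat) (sigma : 'I_k -> {set 'I_n}).
Hypothesis lqA : linear_quotients e A rho sigma.

Let A_homog i j : A i j \is e.-homog. Proof. by case: lqA. Qed.
Let rho_inj : injective rho. Proof. by case: lqA. Qed.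

(** The coefficients expressing X_i times row j through lower rows, chosen
    linear. *)
Lemma reduction_exists : exists c : 'I_k -> 'I_n -> 'rV[S]_k,
  forall j i, i \in sigma j ->
  [/\ supported_below rho (rho j) (c j i), 'X_i *: row j A = c j i *m A
    & forall j', c j i 0 j' \is 1.-homog].
Proof.
have [_ _ lq _] := lqA.
suff red j i : exists c : 'rV[S]_k, i \in sigma j ->
  [/\ supported_below rho (rho j) c, 'X_i *: row j A = c *m A
    & forall j', c 0 j' \is 1.-homog].
  have /fin_all_exists[c Hc] : forall j, exists cj : 'I_n -> 'rV[S]_k,
    forall i, i \in sigma j ->
    [/\ supported_below rho (rho j) (cj i), 'X_i *: row j A = cj i *m A
      & forall j', cj i 0 j' \is 1.-homog].
    by move=> j; have /fin_all_exists := red j.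
  by exists c.
have [si|] := boolP (i \in sigma j); last by exists 0.
have [c c_low cE] := lq j i si.
have c1E : c *m A = map_mx (pihomog mdeg 1) c *m A.
  apply: homogeneous_comb A_homog _ => j'; rewrite -cE !mxE.
  by apply: (dhomogM (d := 1)) => //; rewrite dhomogX; apply/eqP/mdeg1.
exists (map_mx (pihomog mdeg 1) c) => _; split=> [j' /c_low c0||j'].
- by rewrite mxE c0 raddf0.
- by rewrite cE c1E.
by rewrite mxE pihomogP.
Qed.

Variable c : 'I_k -> 'I_n -> 'rV[S]_k.
Hypothesis c_red : forall j i, i \in sigma j ->
  [/\ supported_below rho (rho j) (c j i), 'X_i *: row j A = c j i *m A
    & forall j', c j i 0 j' \is 1.-homog].

Definition syz_index : {set 'I_k * 'I_n} := [set p | p.2 \in sigma p.1].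

Definition syz_mx : 'M[S]_(#|syz_index|, k) :=
  \matrix_(q, j) (let p := enum_val q in
    'X_(p.2) * (j == p.1)%:R - c p.1 p.2 0 j).

(** The lexicographic order on pairs (j, i), flattened to a single number. *)
Definition syz_rho (q : 'I_#|syz_index|) : nat :=
  let p := enum_val q in (rho p.1 * n + p.2)%N.

(** Modulo the syzygies with lower first index, the one attached to (j, i) behaves
    like the generator X_i of (X_i : i in sigma j), and the colon ideal of a
    variable relative to smaller variables is generated by those. *)
Definition syz_sigma (q : 'I_#|syz_index|) : {set 'I_n} :=
  let p := enum_val q in [set i in sigma p.1 | (i < p.2)%N].

Lemma syz_indexP (q : 'I_#|syz_index|) : (enum_val q).2 \in sigma (enum_val q).1.
Proof. by have := enum_valP q; rewrite inE. Qed.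

Lemma syz_index_exists j i : i \in sigma j ->
  exists q : 'I_#|syz_index|, enum_val q = (j, i).
Proof.
move=> si; have ji : (j, i) \in syz_index by rewrite inE.
by exists (enum_rank_in ji (j, i)); rewrite enum_rankK_in.
Qed.

Lemma syz_mx_diag (q : 'I_#|syz_index|) :
  syz_mx q (enum_val q).1 = 'X_((enum_val q).2).
Proof.
have [low _ _] := c_red (syz_indexP q).
by rewrite mxE /= eqxx mulr1 low // subr0.
Qed.

Lemma syz_mx_above (q : 'I_#|syz_index|) j :
  (rho (enum_val q).1 <= rho j)%N -> j != (enum_val q).1 -> syz_mx q j = 0.
Proof.
move=> le_qj /negPf ne_jq; have [low _ _] := c_red (syz_indexP q).
by rewrite mxE /= ne_jq mulr0 low // subr0.
Qed.

Lemma row_syz_mx (q : 'I_#|syz_index|) :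
  row q syz_mx = 'X_((enum_val q).2) *: delta_mx 0 (enum_val q).1
                 - c (enum_val q).1 (enum_val q).2.
Proof. by apply/rowP => j; rewrite !mxE. Qed.

Lemma syz_mxK : syz_mx *m A = 0.
Proof.
apply/row_matrixP => q; rewrite row_mul row_syz_mx mulmxBl -scalemxAl -rowE row0.
by have [_ -> _] := c_red (syz_indexP q); rewrite subrr.
Qed.

Lemma syz_rho_inj : injective syz_rho.
Proof.
move=> q q' eq_qq'; apply: enum_val_inj; move: eq_qq'; rewrite /syz_rho /=.
case: (enum_val q) (enum_val q') => [j i] [j' i'] /= eq_ji.
have n_gt0 : (0 < n)%N by apply: leq_ltn_trans (ltn_ord i).
have := congr1 (divn^~ n) eq_ji; have := congr1 (modn^~ n) eq_ji.
rewrite !modnMDl !divnMDl // !modn_small // !divn_small // !addn0.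
by move=> /val_inj-> /rho_inj->.
Qed.

Lemma syz_rho_lt q q' : (syz_rho q < syz_rho q')%N ->
  (rho (enum_val q).1 < rho (enum_val q').1)%N \/
  (enum_val q).1 = (enum_val q').1 /\ ((enum_val q).2 < (enum_val q').2)%N.
Proof.
rewrite /syz_rho /=; case: (enum_val q) (enum_val q') => [j i] [j' i'] /= lt_qq'.
have [lt_jj'|lt_j'j|/rho_inj eq_jj'] := ltngtP (rho j) (rho j').
- by left.
- have := leq_mul2r n (rho j').+1 (rho j); rewrite lt_j'j orbT mulSn => le_n.
  by have := ltn_ord i'; lia.
by right; move: lt_qq'; rewrite eq_jj' ltn_add2l.
Qed.

Lemma syz_rho_ltl q q' : (rho (enum_val q).1 < rho (enum_val q').1)%N ->
  (syz_rho q < syz_rho q')%N.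
Proof.
rewrite /syz_rho /=; case: (enum_val q) (enum_val q') => [j i] [j' i'] /= lt_jj'.
have := leq_mul2r n (rho j).+1 (rho j'); rewrite lt_jj' orbT mulSn => le_n.
by have := ltn_ord i; lia.
Qed.

(** In a syzygy with leading row j the coefficient of row j lies in the colon
    ideal (X_i : i in sigma j), so a combination of the syzygies attached to the
    pairs (j, i) cancels it, and the rank of the leading row drops. The bound on
    the support of w is what the colon ideals of [syz_mx] require. *)
Lemma syz_mx_generates r (v : 'rV[S]_k) : supported_below rho r v -> v *m A = 0 ->
  exists2 w : 'rV_(#|syz_index|), v = w *m syz_mx
    & forall q, (r <= rho (enum_val q).1)%N -> w 0 q = 0.
Proof.
elim: r v => [|r IHr] v v_low vA0.
  exists 0; last by move=> q _; rewrite mxE.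
  by apply/rowP => j; rewrite v_low // mul0mx mxE.
have [/existsP[j /eqP rho_j]|] := boolP [exists j, rho j == r]; last first.
  rewrite negb_exists => /forallP no_r; have [|w -> w_low] := IHr v _ vA0.
    move=> j; rewrite leq_eqVlt => /orP[/eqP eq_r|]; last exact: v_low.
    by have := no_r j; rewrite eq_r eqxx.
  by exists w => // q le_q; rewrite w_low // ltnW.
have [_ _ _ lq] := lqA.
have [g vjE] : exists g : 'I_n -> S, v 0 j = \sum_(i in sigma j) g i * 'X_i.
  apply: var_ideal_comb; apply: (lq j _ (v 0 j *: delta_mx 0 j - v)).
    move=> j'; rewrite rho_j !mxE eqxx /=; have [->|ne_j] := eqVneq j' j.
      by rewrite mulr1 subrr.
    rewrite mulr0 leq_eqVlt => /orP[/eqP|/v_low ->]; last by rewrite subrr.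
    by rewrite -rho_j => /rho_inj/eqP; rewrite eq_sym (negPf ne_j).
  by rewrite mulmxBl vA0 subr0 -scalemxAl -rowE.
(* w0 cancels the entry of v in column j and touches no higher column. *)
pose w0 : 'rV[S]_(#|syz_index|) :=
  \row_q (if (enum_val q).1 == j then g (enum_val q).2 else 0).
have w0j : (w0 *m syz_mx) 0 j = v 0 j.
  rewrite vjE mxE.
  transitivity (\sum_(q < #|syz_index|)
      (if (enum_val q).1 == j then g (enum_val q).2 * 'X_((enum_val q).2) else 0)).
    apply: eq_bigr => q _; rewrite mxE; case: eqP => [<-|_]; last by rewrite mul0r.
    by rewrite syz_mx_diag.
  rewrite -(big_enum_val (fun p => if p.1 == j then g p.2 * 'X_(p.2) else 0)) /=.
  rewrite -big_mkcondr /=.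
  rewrite (eq_bigl (fun p => (p.1 == j) && (p.2 \in sigma p.1))); last first.
    by move=> p; rewrite inE andbC.
  rewrite -(pair_big_dep (fun j' => j' == j) (fun j' i => i \in sigma j')
              (fun _ i => g i * 'X_i)) /=.
  by rewrite big_pred1_eq.
have w0_above j' : (r < rho j')%N -> (w0 *m syz_mx) 0 j' = 0.
  move=> lt_rj'; rewrite mxE big1 // => q _; rewrite mxE.
  case: eqP => [eq_j|_]; last by rewrite mul0r.
  suff -> : syz_mx q j' = 0 by rewrite mulr0.
  apply: syz_mx_above; rewrite eq_j ?rho_j ?(ltnW lt_rj') //.
  by apply: contraTneq lt_rj' => ->; rewrite rho_j ltnn.
have [||w1 w1E w1_low] := IHr (v - w0 *m syz_mx).
- move=> j'; rewrite leq_eqVlt => /orP[/eqP|lt_r].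
    by rewrite -rho_j => /rho_inj <-; rewrite mxE [X in _ + X]mxE w0j subrr.
  by rewrite mxE [X in _ + X]mxE w0_above // v_low // subr0.
- by rewrite mulmxBl vA0 -mulmxA syz_mxK mulmx0 subrr.
exists (w1 + w0) => [|q lt_r]; first by rewrite mulmxDl -w1E subrK.
rewrite mxE w1_low ?(ltnW lt_r) // add0r mxE.
by case: eqP lt_r => // ->; rewrite rho_j ltnn.
Qed.

(** For i' < i in sigma j, the combination of the syzygies of (j, i) and (j, i')
    with coefficients X_i' and - X_i has no entry in column j, hence comes from
    pairs with lower first index. Conversely column j detects f X_i modulo the
    variables X_i' with i' < i. *)
Lemma linear_quotients_syz_mx : linear_quotients 1 syz_mx syz_rho syz_sigma.
Proof.
split.
- move=> q j; rewrite mxE /=; have [_ _ hc] := c_red (syz_indexP q).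
  apply: rpredB; last exact: hc.
  case: (j == (enum_val q).1); last by rewrite mulr0 rpred0.
  by rewrite mulr1 dhomogX; apply/eqP/mdeg1.
- exact: syz_rho_inj.
- move=> q i'; rewrite inE => /andP[si' lt_i'].
  have [q' q'E] := syz_index_exists si'.
  set v := 'X_i' *: row q syz_mx - 'X_((enum_val q).2) *: row q' syz_mx.
  have vA0 : v *m A = 0.
    by rewrite mulmxBl -!scalemxAl -!row_mul !syz_mxK !row0 !scaler0 subrr.
  have v_low : supported_below rho (rho (enum_val q).1) v.
    move=> j le_j; rewrite !mxE q'E /=.
    have [low _ _] := c_red (syz_indexP q); have [low' _ _] := c_red si'.
    rewrite low // low' // !subr0; case: eqP => _; last by rewrite !mulr0 subrr.
    by rewrite !mulr1 mulrC subrr.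
  have [w wE w_low] := syz_mx_generates v_low vA0.
  exists (w + 'X_((enum_val q).2) *: delta_mx 0 q') => [q''|].
    rewrite leqNgt => /negP nlt; rewrite mxE w_low; last first.
      by rewrite leqNgt; apply/negP => /syz_rho_ltl.
    rewrite !mxE eqxx /=; case: eqP => [eq_q|_]; last by rewrite mulr0 addr0.
    by case: nlt; rewrite eq_q /syz_rho q'E ltn_add2l.
  by rewrite mulmxDl -wE -scalemxAl -rowE subrK.
move=> q f w w_low fE.
have /(var_ideal_mulX _) : in_var_ideal (syz_sigma q) (f * 'X_((enum_val q).2)).
  have := congr1 (fun M : 'rV_k => M 0 (enum_val q).1) fE.
  rewrite mxE [row _ _ _ _]mxE syz_mx_diag => ->; rewrite mxE.
  elim/big_ind: _ => [||q' _]; [exact: var_ideal0|exact: var_idealD|].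
  have [le_q|lt_q] := leqP (syz_rho q) (syz_rho q').
    by rewrite w_low // mul0r; apply: var_ideal0.
  apply: var_idealMl; have [lt_j|[eq_j lt_i]] := syz_rho_lt lt_q.
    rewrite syz_mx_above ?(ltnW lt_j) //; first exact: var_ideal0.
    by apply: contraTneq lt_j => ->; rewrite ltnn.
  rewrite -eq_j syz_mx_diag; apply: var_idealX.
  by rewrite inE -eq_j syz_indexP.
by apply; rewrite inE ltnn andbF.
Qed.

End Syzygies.

Lemma linear_quotients_syzygies (e k l : nat) (A : 'M[S]_(k, l)) rho sigma :
    linear_quotients e A rho sigma ->
  exists (k' : nat) (B : 'M[S]_(k', k)) rho' sigma',
    linear_quotients 1 B rho' sigma' /\
    (forall v : 'rV_k, v *m A = 0 <-> exists w, v = w *m B).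
Proof.
move=> lqA; have [c c_red] := reduction_exists lqA.
exists _, (syz_mx sigma c), (syz_rho rho (sigma:=sigma)), (syz_sigma (sigma:=sigma)).
split=> [|v]; first exact: linear_quotients_syz_mx lqA _ c_red.
split=> [vA0|[w ->]]; last by rewrite -mulmxA (syz_mxK c_red) mulmx0.
have [|w ? _] := syz_mx_generates lqA c_red (r := (\max_j rho j).+1) _ vA0.
  by move=> j; rewrite ltnNge leq_bigmax.
by exists w.
Qed.

End LinearQuotients.
(** * Partial sums of exponents *)

Section PartialSums.
Variable n : nat.
Implicit Types (u v w m : 'X_{1..n}) (k : nat).

Definition psum w k : nat := \sum_(i < n | i < k) w i.

Lemma psum0 w : psum w 0 = 0.
Proof. by rewrite /psum big_pred0. Qed.

Lemma psumS w (i : 'I_n) : psum w i.+1 = psum w i + w i.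
Proof.
rewrite /psum (bigD1 i) //= addnC; congr (_ + _).
by apply: eq_bigl => j; rewrite ltnS [RHS]ltn_neqAle andbC.
Qed.

Lemma psum_ge w k : n <= k -> psum w k = mdeg w.
Proof.
move=> le_nk; rewrite mdegE; apply: eq_bigl => i.
by rewrite (leq_trans (ltn_ord i)).
Qed.

Lemma leq_psum w : {homo psum w : j k / j <= k}.
Proof.
move=> j k le_jk; rewrite /psum [leqLHS]big_mkcond [leqRHS]big_mkcond.
by apply: leq_sum => i _; case: ltnP => // /leq_trans/(_ le_jk)->.
Qed.

Lemma psumD u v k : psum (u + v)%MM k = psum u k + psum v k.
Proof. by rewrite -big_split; apply: eq_bigr => i _; rewrite mnmDE. Qed.

Lemma psumU (i : 'I_n) k : psum U_(i)%MM k = (i < k).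
Proof.
rewrite /psum big_mkcond (bigD1 i) //= big1 => [|j /negPf ne_ji].
  by rewrite mnm1E eqxx addn0; case: ltnP.
by rewrite mnm1E eq_sym ne_ji if_same.
Qed.

Lemma psum_ex (F : nat -> nat) : F 0 = 0 -> (forall k, F k <= F k.+1) ->
    (forall k, n <= k -> F k = F n) ->
  exists w, forall k, psum w k = F k.
Proof.
move=> F0 F_incr F_const; exists [multinom F i.+1 - F i | i < n].
suff psumF k : k <= n -> psum [multinom F i.+1 - F i | i < n] k = F k.
  move=> k; have [/psumF//|lt_nk] := leqP k n.
  by rewrite F_const ?(ltnW lt_nk) // -psumF // !psum_ge // ltnW.
elim: k => [|k IHk] lt_kn; first by rewrite psum0.
by rewrite (psumS _ (Ordinal lt_kn)) /= IHk 1?ltnW // mnmE subnKC.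
Qed.

End PartialSums.

(** * Monomials with bounded window sums *)

Section CappedMonomials.
Variables (n d : nat) (caps : seq (nat * nat * nat)).
Implicit Types (u v w z m : 'X_{1..n}) (s N : nat).

(** A triple (a, b, k) of [caps] bounds by k the number of elements in
    {a, ..., b - 1}, for the generators; both the bounds and the degree scale
    with s. *)
Definition capped s w : bool :=
  (mdeg w == s * d) &&
  all (fun p => psum w p.1.2 <= psum w p.1.1 + s * p.2) caps.

Lemma cappedP s w :
  reflect (mdeg w = s * d /\
           forall a b k, (a, b, k) \in caps -> psum w b <= psum w a + s * k)
          (capped s w).
Proof.
apply: (iffP andP) => -[/eqP deg_w caps_w]; split=> //.
  by move=> a b k /(allP caps_w).
by apply/allP => -[[a b] k] /caps_w.
Qed.

Lemma capped0 : capped 0 0%MM.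
Proof.
apply/cappedP; split=> [|a b k _]; first by rewrite mdeg0.
by rewrite mul0n addn0 {1}/psum big1 // => i _; rewrite mnm0E.
Qed.

Lemma cappedD s1 s2 u v : capped s1 u -> capped s2 v -> capped (s1 + s2) (u + v)%MM.
Proof.
move=> /cappedP[deg_u caps_u] /cappedP[deg_v caps_v]; apply/cappedP.
split=> [|a b k in_caps]; first by rewrite mdegD deg_u deg_v mulnDl.
by rewrite !psumD mulnDl addnACA leq_add ?caps_u ?caps_v.
Qed.

(** From F b <= F a + N k follows floor (F b / N) <= floor (F a / N) + k, since k
    is an integer. *)
Lemma capped_floor N s w : 0 < N -> capped (N * s) w ->
  exists2 z, capped s z & forall k, psum z k = psum w k %/ N.
Proof.
move=> N_gt0 /cappedP[deg_w caps_w].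
have [|||z zE] := @psum_ex n (fun k => psum w k %/ N).
- by rewrite psum0 div0n.
- by move=> k; rewrite leq_div2r // leq_psum.
- by move=> k le_nk; rewrite !psum_ge.
exists z => //; apply/cappedP; split=> [|a b k in_caps].
  by rewrite -(psum_ge z (leqnn n)) zE psum_ge // deg_w -mulnA mulKn.
rewrite !zE -(divnDMl _ _ N_gt0) leq_div2r //.
by rewrite mulnC mulnA caps_w.
Qed.

Lemma leq_divD N x y : 0 < N -> (x + y) %/ N <= x %/ N + y.
Proof.
by move=> N_gt0; rewrite -(divnDMl _ _ N_gt0) leq_div2r // leq_add2l leq_pmulr.
Qed.

(** The counterpart of [capped_floor] for the complement x - floor (x / (s + 1)),
    which is s x / (s + 1) rounded up. *)
Lemma ceil_cap s k x y : x <= y + s.+1 * k ->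
  x - x %/ s.+1 <= y - y %/ s.+1 + s * k.
Proof.
move=> /subnKC; set y' := y + _ => xE.
have y'E : y' %/ s.+1 = y %/ s.+1 + k by rewrite /y' mulnC divnDMl.
have := leq_divD x (y' - x) (ltn0Sn s); rewrite xE y'E.
have := leq_div y s.+1; have := leq_div x s.+1.
by move: xE; rewrite /y' mulSn; lia.
Qed.

(** With u given by the floors of F / (s + 1), this is the sorting of the (s + 1) d
    elements into s + 1 lists, of which u collects every (s + 1)-st element. *)
Lemma capped_split s w : capped s.+1 w ->
  exists u z, [/\ capped 1 u, capped s z & w = (u + z)%MM].
Proof.
move=> cap_w; have [] := @capped_floor s.+1 1 w isT; first by rewrite muln1.
move=> u cap_u uE.
have le_uw : (u <= w)%MM.
  apply/mnm_lepP => i; have := psumS u i; rewrite !uE psumS => eq_u.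
  by rewrite -(leq_add2l (psum w i %/ s.+1)) -eq_u leq_divD.
have psum_wu k : psum (w - u)%MM k = psum w k - psum w k %/ s.+1.
  by rewrite -uE -[in psum w k](submK le_uw) psumD addnK.
exists u, (w - u)%MM; split; rewrite 1?addmC ?submK //.
have [/cappedP[deg_w caps_w] /cappedP[deg_u _]] := (cap_w, cap_u).
apply/cappedP; split=> [|a b k in_caps].
  have := congr1 mdeg (submK le_uw); rewrite mdegD deg_w deg_u mul1n mulSn addnC.
  exact: addnI.
by rewrite !psum_wu ceil_cap // caps_w.
Qed.

(** The floors F' of F / N satisfy F' (i + 1) - F' i <= m i because
    F (i + 1) - F i <= N m i. *)
Lemma capped_round N s w m : 0 < N -> capped (N * s) w -> (w <= m *+ N)%MM ->
  exists2 z, capped s z & (z <= m)%MM.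
Proof.
move=> N_gt0 cap_w /mnm_lepP le_wm; have [z cap_z zE] := capped_floor N_gt0 cap_w.
exists z => //; apply/mnm_lepP => i; have := psumS z i; rewrite !zE psumS => eq_z.
rewrite -(leq_add2l (psum w i %/ N)) -eq_z -(divnDMl _ _ N_gt0) leq_div2r //.
by rewrite leq_add2l; have := le_wm i; rewrite mulmnE.
Qed.

Lemma iter_cycle (T : finType) (f : T -> T) x :
  exists i N, 0 < N /\ iter N f (iter i f x) = iter i f x.
Proof.
have /injectivePn[i [j ne_ij /= eq_ij]] :
    ~~ injectiveb (fun i : 'I_#|T|.+1 => iter i f x).
  by apply/injectiveP => /leq_card; rewrite card_ord ltnn.
wlog lt_ij : i j ne_ij eq_ij / i < j.
  move=> wl; case: (ltngtP i j) => [|lt_ji|/val_inj eq]; first exact: wl.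
    by apply: (wl j i) => //; rewrite eq_sym.
  by rewrite eq eqxx in ne_ij.
by exists i, (j - i); rewrite subn_gt0 -iterD subnK ?(ltnW lt_ij).
Qed.

(** The exponents m such that x^m lies in the colon ideal of the (s + 1)-st power
    by the ideal; see the cycle argument in the introduction. *)
Lemma capped_colon s m : (exists u, capped 1 u) ->
    (forall u, capped 1 u -> exists2 w, capped s.+1 w & (w <= m + u)%MM) ->
  exists2 z, capped s z & (z <= m)%MM.
Proof.
move=> [u0 cap_u0] colon_m.
have deg_capped u : capped 1 u -> mdeg u < d.+1.
  by case/cappedP=> ->; rewrite mul1n.
have /fin_all_exists[f fP] (b : 'X_{1..n < d.+1}) :
    exists p : 'X_{1..n < d.+1} * 'X_{1..n}, capped 1 b ->
    [/\ capped 1 p.1, capped s p.2 & (p.2 + p.1 <= m + b)%MM].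
  have [/colon_m[w /capped_split[u [z [cap_u cap_z ->]]] le_uz]|] :=
    boolP (capped 1 b); last by exists (b, 0%MM).
  by exists (BMultinom (deg_capped u cap_u), z) => _; split; rewrite // addmC.
pose next b := (f b).1.
have iterP N (b : 'X_{1..n < d.+1}) : capped 1 b -> capped 1 (iter N next b) /\
    exists2 Z, capped (N * s) Z & (Z + iter N next b <= m *+ N + b)%MM.
  move=> cap_b; elim: N => [|N [cap_N [Z cap_Z le_Z]]].
    by split=> //; exists 0%MM; rewrite ?mul0n ?capped0 ?mulm0n ?lepm_refl.
  have [cap_next cap_z le_z] := fP _ cap_N; split=> //.
  exists ((f (iter N next b)).2 + Z)%MM; first by rewrite mulSn cappedD.
  apply/mnm_lepP => i; move/mnm_lepP/(_ i): le_z; move/mnm_lepP/(_ i): le_Z.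
  by rewrite !mnmDE !mulmnE /= -/(next _) mulnS; lia.
pose b0 : 'X_{1..n < d.+1} := BMultinom (deg_capped u0 cap_u0).
(* On the cycle the generators at both ends cancel. *)
have [i [N [N_gt0 cyc]]] := iter_cycle next b0.
have [cap_b _] := iterP i b0 cap_u0.
have [_ [Z cap_Z]] := iterP N _ cap_b; rewrite cyc => le_Z.
apply: capped_round N_gt0 cap_Z _; apply/mnm_lepP => j.
by move/mnm_lepP/(_ j): le_Z; rewrite !mnmDE leq_add2r.
Qed.

(** With j the first index after i at which the partial sums of u no longer
    exceed those of v, the new monomial is v + U_(i) - U_(j). A window
    {a, ..., b - 1} gains a unit only if a <= i < b <= j, and then the partial sums
    of v and u agree at a while at b that of v is the smaller one. *)
Lemma capped_exchange s u v : capped s u -> capped s v -> (v < u)%O ->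
  exists2 i, v i < u i &
    exists w, [/\ capped s w, (v < w)%O & (w <= v + U_(i))%MM].
Proof.
move=> /cappedP[deg_u caps_u] /cappedP[deg_v caps_v].
move=> /ltmcP-/(_ (etrans deg_v (esym deg_u)))[i eq_lt_i lt_i]; exists i => //.
have psum_eq k : k <= i -> psum v k = psum u k.
  move=> le_ki; apply: eq_bigr => j lt_jk.
  by rewrite eq_lt_i // (leq_trans lt_jk).
(* The prefix of length j + 1 is the first one where v has caught up. *)
have [j /andP[lt_ij le_j] j_min] : exists2 j : 'I_n,
    (i < j) && (psum u j.+1 <= psum v j.+1)
  & forall k, i < k <= j -> psum v k < psum u k.
  have ex_k : exists k, (i < k) && (psum u k.+1 <= psum v k.+1).
    by exists n; rewrite ltn_ord !psum_ge ?leqnSn // deg_u deg_v leqnn.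
  case: (ex_minnP ex_k) => k /andP[lt_ik le_k] k_min.
  have low_k k' : i < k' <= k -> psum v k' < psum u k'.
    case: k' => // k' /andP[]; rewrite ltnS leq_eqVlt => /orP[/eqP<- _|lt_ik' lt_k'k].
      by rewrite !psumS psum_eq // ltn_add2l.
    by rewrite ltnNge; apply: contraL lt_k'k => le_k'; rewrite -leqNgt k_min ?lt_ik'.
  have lt_kn : k < n.
    rewrite ltnNge; apply/negP => le_nk; have := low_k k.
    by rewrite lt_ik leqnn !psum_ge // deg_u deg_v ltnn => /(_ isT).
  by exists (Ordinal lt_kn); rewrite /= ?lt_ik.
have vj_gt0 : 0 < v j.
  by move: le_j (j_min j); rewrite !psumS lt_ij leqnn => ? /(_ isT); lia.
have ne_ij : i != j by rewrite neq_ltn lt_ij.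
have le_Uj : (U_(j) <= v + U_(i))%MM.
  apply/mnm_lepP => j'; rewrite mnmDE !mnm1E.
  by case: eqP => // <-; rewrite ltn_addr.
exists (v + U_(i) - U_(j))%MM; set w := (_ - _)%MM.
have wE : (w + U_(j) = v + U_(i))%MM by rewrite submK.
have deg_w : mdeg w = mdeg v.
  by have := congr1 mdeg wE; rewrite !mdegD !mdeg1; lia.
have psum_w k : psum w k + (j < k) = psum v k + (i < k).
  by have := congr1 (fun x => psum x k) wE; rewrite /= !psumD !psumU.
split; last by rewrite lem_subr.
- apply/cappedP; split=> [|a b k in_caps]; first by rewrite deg_w.
  have [le_ab|lt_ba] := leqP a b; last first.
    by apply: leq_trans (leq_addr _ _); rewrite leq_psum // ltnW.
  have cap_v := caps_v _ _ _ in_caps; have cap_u := caps_u _ _ _ in_caps.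
  have [psum_wa psum_wb] := (psum_w a, psum_w b).
  have [lt_ib|] := ltnP i b; last by lia.
  have [lt_jb|le_bj] := ltnP j b; first by lia.
  have [lt_ia|le_ai] := ltnP i a; first by lia.
  by have := psum_eq a le_ai; have := j_min b; rewrite lt_ib le_bj => /(_ isT); lia.
apply/ltmcP => //; exists i => [i' lt_i'i|].
  rewrite mnmBE mnmDE !mnm1E -!val_eqE /=.
  by rewrite !gtn_eqF ?addn0 ?subn0 // (ltn_trans lt_i'i).
by rewrite mnmBE mnmDE !mnm1E eqxx eq_sym (negPf ne_ij) subn0 addn1.
Qed.

End CappedMonomials.
(** * From linear quotients to linear resolutions *)

Section Resolution.
Local Open Scope ring_scope.
Variables (K : fieldType) (n : nat).
Local Notation S := {mpoly K[n]}.

(** The column count is a parameter, so that consecutive matrices of the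
    resolution compose by construction. *)
Record lq_matrix (l : nat) := LqMatrix {
  lq_rows : nat;
  lq_deg : nat;
  lq_mx : 'M[S]_(lq_rows, l);
  lq_ok : exists rho sigma, linear_quotients lq_deg lq_mx rho sigma
}.

Lemma syzygy_matrix_ex (l : nat) (T : lq_matrix l) :
  exists T' : lq_matrix (lq_rows T), lq_deg T' = 1%N /\
    (forall v : 'rV_(lq_rows T), v *m lq_mx T = 0 <-> exists w, v = w *m lq_mx T').
Proof.
have [rho [sigma lqT]] := lq_ok T.
have [k [B [rho' [sigma' [lqB exB]]]]] := linear_quotients_syzygies lqT.
have okB : exists rho sigma, linear_quotients 1 B rho sigma by exists rho', sigma'.
by exists (LqMatrix okB).
Qed.

Definition syzygy_matrix (l : nat) (T : lq_matrix l) : lq_matrix (lq_rows T) :=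
  proj1_sig (constructive_indefinite_description _ (syzygy_matrix_ex T)).

Lemma syzygy_matrixP (l : nat) (T : lq_matrix l) :
  lq_deg (syzygy_matrix T) = 1%N /\
  (forall v : 'rV_(lq_rows T),
     v *m lq_mx T = 0 <-> exists w, v = w *m lq_mx (syzygy_matrix T)).
Proof. by rewrite /syzygy_matrix; case: constructive_indefinite_description. Qed.

Definition next_stage (T : {l & lq_matrix l}) : {l & lq_matrix l} :=
  existT lq_matrix (lq_rows (projT2 T)) (syzygy_matrix (projT2 T)).

(** All matrices after the augmentation have entries of degree 1, which gives
    the shifts q + i and minimality at once. *)
Lemma linear_quotients_resolution (q k : nat) (A : 'cV[S]_k) rho sigma
    (I : S -> Prop) :
    linear_quotients q A rho sigma ->
    (forall f, I f <-> exists v : 'rV_k, f = (v *m A) 0 0) ->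
  has_linear_resolution I.
Proof.
move=> lqA IE.
have okA : exists rho sigma, linear_quotients q A rho sigma by exists rho, sigma.
pose T0 : {l & lq_matrix l} := existT lq_matrix 1%N (LqMatrix okA).
pose T i := iter i next_stage T0.
pose len i := lq_rows (projT2 (T i)).
pose F := @FreeSeq K n len (fun i _ => (q + i)%N)
  (fun i => lq_mx (projT2 (T i.+1)) : 'M_(len i.+1, len i)) A.
have deg_diff i : lq_deg (projT2 (T i.+1)) = 1%N.
  by have [] := syzygy_matrixP (projT2 (T i)).
have homog_diff i j l : diff F i j l \is 1.-homog.
  have [r [s [homogT _ _ _]]] := lq_ok (projT2 (T i.+1)).
  by have := homogT j l; rewrite deg_diff.
exists F; split; last by exists q.
split.
- split=> [j|i j l m /(dhomog_mf (homog_diff i j l)) /= ->].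
    by have [homogA _ _ _] := lqA; rewrite /= addn0; apply: homogA.
  by rewrite addnS addnC addn1.
- split=> [//|v|i v]; first exact: (proj2 (syzygy_matrixP (LqMatrix okA))).
  exact: (proj2 (syzygy_matrixP (projT2 (T i.+1)))).
move=> i j l; apply: (dhomog_nemf_coeff (homog_diff i j l)).
by rewrite /= mdeg0.
Qed.

End Resolution.
(** * Generated ideals and monomial ideals *)

Section GeneratedIdeals.
Local Open Scope ring_scope.
Variable R : comNzRingType.
Implicit Types (G I : R -> Prop) (f g : R).

Lemma ideal_gen_incl G f : G f -> ideal_gen G f.
Proof.
move=> Gf; exists 1%N, (fun=> 1), (fun=> f); split=> //.
by rewrite big_ord1 mul1r.
Qed.

Lemma ideal_gen0 G : ideal_gen G 0.
Proof.
exists 0%N, (fun=> 0), (fun=> 0).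
by split=> [[]|] //; rewrite big_ord0.
Qed.

Lemma ideal_genD G f g : ideal_gen G f -> ideal_gen G g -> ideal_gen G (f + g).
Proof.
move=> [k [a [x [Gx ->]]]] [l [b [y [Gy ->]]]].
pose pick (T : Type) (u : 'I_k -> T) (v : 'I_l -> T) (i : 'I_(k + l)) : T :=
  match split i with inl j => u j | inr j => v j end.
exists (k + l)%N, (pick _ a b), (pick _ x y); split.
  by move=> i; rewrite /pick; case: split.
rewrite big_split_ord /pick; congr (_ + _); apply: eq_bigr => i _.
  case: splitP => [j /= /val_inj->//|j /= ij].
  by have := ltn_ord i; rewrite ij; lia.
case: splitP => [j /= ij|j /= /addnI/val_inj->//].
by have := ltn_ord j; rewrite -ij; lia.
Qed.

Lemma ideal_genMl G f g : ideal_gen G f -> ideal_gen G (g * f).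
Proof.
move=> [k [a [x [Gx ->]]]]; exists k, (fun i => g * a i), x; split=> //.
by rewrite mulr_sumr; apply: eq_bigr => i _; rewrite mulrA.
Qed.

Lemma ideal_gen_sub G I : I 0 -> (forall f g, I f -> I g -> I (f + g)) ->
    (forall f g, I f -> I (g * f)) -> (forall f, G f -> I f) ->
  forall f, ideal_gen G f -> I f.
Proof.
move=> I0 ID IM subGI _ [k [a [x [Gx ->]]]].
by elim/big_ind: _ => [||i _] //; apply/IM/subGI.
Qed.

End GeneratedIdeals.

Section MonomialIdeals.
Local Open Scope ring_scope.
Variables (K : fieldType) (n : nat).
Local Notation S := {mpoly K[n]}.
Implicit Types (P : pred 'X_{1..n}) (f g : S).

Definition mono_ideal P f : Prop :=
  forall m, m \in msupp f -> exists2 w, P w & (w <= m)%MM.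

Lemma mono_ideal0 P : mono_ideal P 0.
Proof. by move=> m; rewrite msupp0. Qed.

Lemma mono_idealD P f g : mono_ideal P f -> mono_ideal P g -> mono_ideal P (f + g).
Proof. by move=> hf hg m /msuppD_le; rewrite mem_cat => /orP[/hf|/hg]. Qed.

Lemma mono_idealMl P f g : mono_ideal P f -> mono_ideal P (g * f).
Proof.
move=> hf m /msuppM_le /allpairsP[[m1 m2] /= [_ /hf[w Pw le_w] ->]].
by exists w => //; apply: lepm_trans le_w (lem_addl _ _).
Qed.

Lemma mono_idealX P w : P w -> mono_ideal P 'X_[w].
Proof. by move=> Pw m; rewrite msuppX inE => /eqP->; exists w; rewrite ?lepm_refl. Qed.

Lemma mono_ideal_sub P (I : S -> Prop) :
    I 0 -> (forall f g, I f -> I g -> I (f + g)) ->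
    (forall f g, I f -> I (g * f)) -> (forall w, P w -> I 'X_[w]) ->
  forall f, mono_ideal P f -> I f.
Proof.
move=> I0 ID IM IX f hf; rewrite [f]mpolyE big_seq.
elim/big_ind: _ => [||m /hf[w Pw le_w]] //.
by rewrite -(submK le_w) mpolyXD scalerAl; apply/IM/IX.
Qed.

End MonomialIdeals.
(** * Ideals of monomials with bounded window sums *)

Section CappedIdeals.
Local Open Scope ring_scope.
Variables (K : fieldType) (n d : nat) (caps : seq (nat * nat * nat)).
Local Notation S := {mpoly K[n]}.
Local Notation capped := (@capped n d caps).

Lemma capped_mono_idealM s (f g : S) :
  mono_ideal (capped 1) f -> mono_ideal (capped s) g ->
  mono_ideal (capped s.+1) (f * g).
Proof.
move=> hf hg m /msuppM_le /allpairsP[[m1 m2] /= [/hf[u cap_u le_u] /hg[z cap_z le_z] ->]].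
exists (u + z)%MM; first exact: (cappedD cap_u cap_z).
apply/mnm_lepP => i; rewrite !mnmDE.
exact: leq_add (mnm_lepP le_u i) (mnm_lepP le_z i).
Qed.

Lemma ideal_pow_capped (I : S -> Prop) : ideal_eq I (mono_ideal (capped 1)) ->
  forall s, ideal_eq (ideal_pow I s) (mono_ideal (capped s)).
Proof.
move=> IE; elim=> [|s IHs] f /=.
  split=> // _ m _; exists 0%MM; first exact: capped0.
  by apply/mnm_lepP => i; rewrite mnm0E.
split.
  apply: ideal_gen_sub; [exact: mono_ideal0|exact: mono_idealD|exact: mono_idealMl|].
  by move=> _ [g [h [/IE hg /IHs hh ->]]]; apply: capped_mono_idealM.
apply: mono_ideal_sub; [exact: ideal_gen0|exact: ideal_genD|exact: ideal_genMl|].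
move=> w /capped_split[u [z [cap_u cap_z ->]]]; apply: ideal_gen_incl.
exists 'X_[u], 'X_[z]; split; last exact: mpolyXD.
  exact/IE/mono_idealX.
exact/IHs/mono_idealX.
Qed.

Lemma capped_strong_persistence (I : S -> Prop) :
    ideal_eq I (mono_ideal (capped 1)) -> (exists u, capped 1 u) ->
  strong_persistence I.
Proof.
move=> IE ex_u s _ f; have powE := ideal_pow_capped IE; split; last first.
  by move=> If g Ig; apply: ideal_gen_incl; exists g, f; rewrite mulrC.
move=> colon_f; apply/powE => m mf; apply: (capped_colon ex_u) => u cap_u.
have /powE : ideal_pow I s.+1 (f * 'X_[u]) by apply/colon_f/IE/mono_idealX.
apply; rewrite (perm_mem (msuppMX _ _)); apply/mapP; exists m => //.
by rewrite addmC.
Qed.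

Section LinearQuotients.
Variable s : nat.
Local Notation T := 'X_{1..n < (s * d).+1}.

Definition capped_set : {set T} := [set b : T | capped s b].

Definition capped_gen (j : 'I_#|capped_set|) : 'X_{1..n} := enum_val j.

Definition capped_col : 'cV[S]_#|capped_set| := \col_j 'X_[capped_gen j].

(** Counting the larger monomials ranks lexicographically larger monomials
    first. *)
Definition capped_rho (j : 'I_#|capped_set|) : nat :=
  #|[set b : T | (capped_gen j < bmnm b)%O]|.

Definition capped_sigma (j : 'I_#|capped_set|) : {set 'I_n} :=
  [set i | [exists j', (capped_gen j < capped_gen j')%O
                       && (capped_gen j' <= capped_gen j + U_(i))%MM]].

Lemma capped_genP j : capped s (capped_gen j).
Proof. by have := enum_valP j; rewrite inE. Qed.

Lemma capped_gen_ex w : capped s w -> exists j, capped_gen j = w.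
Proof.
move=> cap_w; have /cappedP[deg_w _] := cap_w.
have lt_w : (mdeg w < (s * d).+1)%N by rewrite deg_w.
have w_in : BMultinom lt_w \in capped_set by rewrite inE.
exists (enum_rank_in w_in (BMultinom lt_w)).
by rewrite /capped_gen enum_rankK_in.
Qed.

Lemma capped_rho_lt j j' :
  (capped_rho j < capped_rho j')%N = (capped_gen j' < capped_gen j)%O.
Proof.
have rho_lt j1 j2 : (capped_gen j2 < capped_gen j1)%O ->
    (capped_rho j1 < capped_rho j2)%N.
  move=> lt_21; apply: proper_card; apply/properP; split.
    by apply/subsetP => b; rewrite !inE; apply: Order.POrderTheory.lt_trans.
  by exists (enum_val j1); rewrite !inE ?lt_21 // Order.POrderTheory.ltxx.
apply/idP/idP; last exact: rho_lt.
have [/rho_lt lt12 /(ltn_trans lt12)|//|eq12] :=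
  Order.TotalTheory.ltgtP (capped_gen j) (capped_gen j').
  by rewrite ltnn.
by rewrite /capped_rho eq12 ltnn.
Qed.

Lemma capped_linear_quotients :
  linear_quotients (s * d) capped_col capped_rho capped_sigma.
Proof.
split.
- move=> j l; rewrite mxE dhomogX; apply/eqP.
  by have /cappedP[] := capped_genP j.
- move=> j j' eq_rho; apply/enum_val_inj/val_inj/eqP.
  have := capped_rho_lt j j'; have := capped_rho_lt j' j.
  rewrite eq_rho ltnn -[_ == _]/(capped_gen j == capped_gen j').
  by case: Order.TotalTheory.ltgtP.
- move=> j i; rewrite inE => /existsP[j' /andP[lt_jj' le_j']].
  exists ('X_[capped_gen j + U_(i) - capped_gen j'] *: delta_mx 0 j').
    move=> j''; rewrite leqNgt !mxE eqxx /=; case: eqP => [->|_]; last by rewrite mulr0.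
    by rewrite capped_rho_lt lt_jj'.
  rewrite -scalemxAl -rowE; apply/rowP => l.
  by rewrite !mxE -!mpolyXD submK // addmC.
move=> j f c c_low /rowP/(_ 0) fE m mf.
have : (capped_gen j + m)%MM \in msupp (f * 'X_[capped_gen j]).
  by rewrite (perm_mem (msuppMX _ _)) map_f.
have -> : f * 'X_[capped_gen j] = (c *m capped_col) 0 0 by rewrite -fE !mxE.
rewrite mxE => /msupp_sum_le /flattenP[_ /mapP[j' _ ->]].
have [/c_low->|lt_j'] := leqP (capped_rho j) (capped_rho j').
  by rewrite mul0r msupp0.
rewrite mxE (perm_mem (msuppMX _ _)) => /mapP[m' _ eq_m].
have := lt_j'; rewrite capped_rho_lt.
move=> /(capped_exchange (capped_genP j') (capped_genP j))[i lt_i [w [cap_w lt_w le_w]]].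
exists i.
  have [j'' wE] := capped_gen_ex cap_w.
  by rewrite inE; apply/existsP; exists j''; rewrite wE lt_w.
have := congr1 (fun x : 'X_{1..n} => x i) eq_m; rewrite /= !mnmDE.
by move: lt_i; lia.
Qed.

End LinearQuotients.

Lemma capped_linear_resolution s (I : S -> Prop) :
  ideal_eq I (mono_ideal (capped s)) -> has_linear_resolution I.
Proof.
move=> IE; apply: (linear_quotients_resolution (capped_linear_quotients s)) => f.
split.
  move/IE; move: f.
  apply: (mono_ideal_sub (I := fun f => exists v, f = (v *m capped_col s) 0 0)).
  - by exists 0; rewrite mul0mx mxE.
  - by move=> _ _ [v ->] [w ->]; exists (v + w); rewrite mulmxDl !mxE.
  - by move=> _ g [v ->]; exists (g *: v); rewrite -scalemxAl !mxE.
  move=> w /capped_gen_ex[j wE]; exists (delta_mx 0 j).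
  by rewrite -rowE !mxE wE.
move=> [v ->]; apply/IE; rewrite mxE.
elim/big_ind: _ => [||j _]; [exact: mono_ideal0|exact: mono_idealD|].
by apply/mono_idealMl; rewrite mxE; apply/mono_idealX/capped_genP.
Qed.

End CappedIdeals.
(** * Bounded spread multisets *)

Section VeroneseMultisets.
Variables (n d c t : nat).
Implicit Types (A B : seq 'I_n) (s : seq nat).

(** For t = 0 the first family consists of empty windows, and the second one
    bounds the multiplicities by c. *)
Definition veronese_caps : seq (nat * nat * nat) :=
  [seq (a, a + t, 1) | a <- iota 0 n] ++
  [seq (a, a + (c * t).+1, c) | a <- iota 0 n].

Definition mset_mnm A : 'X_{1..n} := (\big[+%MM/0]_(i <- A) U_(i))%MM.

Lemma mon_mset (K : fieldType) A : mon K A = 'X_[K, mset_mnm A]%R.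
Proof.
by rewrite /mset_mnm (big_morph _ (@mpolyXD _ _) (@mpolyX0 _ _)).
Qed.

Lemma mdeg_mset A : mdeg (mset_mnm A) = size A.
Proof.
rewrite mdeg_sum -sum1_size; apply: eq_bigr => i _; exact: mdeg1.
Qed.

Lemma psum_mset A k : psum (mset_mnm A) k = count (fun x => x < k) (map val A).
Proof.
rewrite /mset_mnm count_map -sum1_count [RHS]big_mkcond.
have psum0m : psum (0%MM : 'X_{1..n}) k = 0.
  by rewrite /psum big1 // => i _; rewrite mnm0E.
rewrite (big_morph (fun w => psum w k) (fun u v => psumD u v k) psum0m).
by apply: eq_bigr => i _; rewrite psumU /=; case: ltnP.
Qed.

Lemma mset_mnm_surj w : exists2 A, is_multiset A & mset_mnm A = w.
Proof.
pose A0 := flatten [seq nseq (w i) i | i <- enum 'I_n].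
exists (sort (fun i j : 'I_n => i <= j) A0).
  by apply: sort_sorted => i j; apply: leq_total.
rewrite /mset_mnm (perm_big A0) ?perm_sort //=.
rewrite big_flatten /= big_map [RHS]multinomUE_id big_enum /=.
apply: eq_bigr => i _; rewrite big_nseq; elim: (w i) => //= k ->.
by rewrite mulmS.
Qed.

Lemma sorted_nth_lt s i x : sorted leq s -> i < size s ->
  (nth 0 s i < x) = (i < count (fun y => y < x) s).
Proof.
move=> s_sorted lt_i; apply/idP/idP; last exact: Order.POrderTheory.nth_count_lt.
apply: contraTT; rewrite -!leqNgt => le_i.
by apply: (@Order.TotalTheory.DualTotalTheory.nth_count_ge _ nat) => //; apply/andP.
Qed.

Lemma spread_nth s j k : sorted (fun x y => x + t <= y) s -> j + k < size s ->
  nth 0 s j + k * t <= nth 0 s (j + k).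
Proof.
move=> /(sortedP 0) spread_s; elim: k => [|k IHk] lt_jk; first by rewrite !addn0.
have := IHk (ltnW _); rewrite -addnS => /(_ lt_jk).
by have := spread_s (j + k); rewrite -addnS mulSn => /(_ lt_jk); lia.
Qed.

(** In a t-spread list the entries at positions j and j + c differ by at least
    c t, with equality exactly when they delimit a block of size c + 1; so it
    suffices to forbid equality. *)
Lemma bounded_spreadP A : bounded_spread c d t A <->
  [/\ is_multiset A, size A = d, spread t A
    & forall j, j + c < d -> nth 0 (map val A) (j + c) != nth 0 (map val A) j + c * t].
Proof.
set s := map val A.
have size_s : size s = size A by rewrite size_map.
have spread_s : spread t A = sorted (fun x y => x + t <= y) s.
  by rewrite sorted_map.
split=> -[ms_A size_A spr_A bnd_A]; split=> //; rewrite spread_s in spr_A.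
- move=> j lt_jc; apply/eqP => eq_jc.
  have size_B : size (take c.+1 (drop j A)) = c.+1.
    by rewrite size_takel // size_drop; lia.
  suff /bnd_A : block t A (take c.+1 (drop j A)) by rewrite size_B ltnn.
  apply/andP; split.
    by apply/infixP; exists (take j A), (drop c.+1 (drop j A)); rewrite !cat_take_drop.
  have -> : sorted (fun i j : 'I_n => i + t == j) (take c.+1 (drop j A)) =
            sorted (fun x y => x + t == y) (take c.+1 (drop j s)).
    by rewrite /s -map_drop -map_take sorted_map.
  apply/(sortedP 0) => i; rewrite size_takel ?size_drop; last by lia.
  rewrite ltnS => lt_ic; rewrite !nth_take ?ltnS ?(ltnW lt_ic) // !nth_drop.
  have cE : c * t = i * t + t + (c - i.+1) * t.
    by rewrite -{1}(subnKC lt_ic) mulnDl mulSn [t + _]addnC.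
  have := @spread_nth s (j + i.+1) (c - i.+1) spr_A.
  rewrite size_s size_A -addnA subnKC // => /(_ lt_jc) le_c.
  have := @spread_nth s j i spr_A; have := @spread_nth s (j + i) 1 spr_A.
  by rewrite size_s size_A mul1n addn1 -[in nth 0 s _.+1]addnS; lia.
move=> B /andP[/infixP[p [q AE]]]; rewrite leqNgt => eqB; apply/negP => lt_cB.
have sE : s = map val p ++ map val B ++ map val q by rewrite /s AE !map_cat.
have nth_B i : i <= c -> nth 0 s (size p + i) = nth 0 (map val B) 0 + i * t.
  have nth_s k : k < size B -> nth 0 s (size p + k) = nth 0 (map val B) k.
    move=> lt_k; rewrite sE nth_cat size_map ltnNge leq_addr /= addKn.
    by rewrite nth_cat size_map lt_k.
  have /(sortedP 0) eqB' : sorted (fun x y => x + t == y) (map val B).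
    by rewrite sorted_map.
  move=> le_ic; rewrite nth_s; last exact: leq_ltn_trans lt_cB.
  elim: i le_ic => [|i IHi] lt_ic; first by rewrite addn0.
  have := eqB' i; rewrite size_map (leq_ltn_trans lt_ic lt_cB) => /(_ isT)/eqP <-.
  by rewrite IHi 1?ltnW // mulSn; lia.
have lt_d : size p + c < d.
  by rewrite -size_A AE !size_cat ltn_add2l (leq_trans lt_cB) ?leq_addr.
have := nth_B 0 isT; rewrite mul0n !addn0 => nth_B0.
by have := bnd_A _ lt_d; rewrite nth_B0 nth_B // eqxx.
Qed.

(** Since the list is sorted, entry number i is below x exactly when more than i
    elements are, so that window bounds translate into gaps between entries j
    and j + k. *)
Lemma bounded_spread_capped A : is_multiset A ->
  bounded_spread c d t A <-> capped d veronese_caps 1 (mset_mnm A).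
Proof.
move=> ms_A; set w := mset_mnm A; set s := map val A.
have size_s : size s = size A by rewrite size_map.
have s_sorted : sorted leq s by rewrite sorted_map.
have spread_s : spread t A = sorted (fun x y => x + t <= y) s by rewrite sorted_map.
have lt_psum i x : i < size A -> (nth 0 s i < x) = (i < psum w x).
  by move=> lt_i; rewrite psum_mset sorted_nth_lt // size_s.
have psum_size x : psum w x <= size A by rewrite psum_mset -size_s count_size.
have window a b k : ~~ (psum w b <= psum w a + k) ->
    [/\ psum w a + k < size A, a <= nth 0 s (psum w a)
      & nth 0 s (psum w a + k) < b].
  rewrite -ltnNge => lt_k; have lt_jk := leq_trans lt_k (psum_size b).
  split=> //; last by rewrite lt_psum.
  by rewrite leqNgt lt_psum ?ltnn //; apply: leq_ltn_trans lt_jk; apply: leq_addr.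
have window_nth a b k j : psum w b <= psum w a + k -> j + k < size A ->
    a <= nth 0 s j -> b <= nth 0 s (j + k).
  move=> cap_ab lt_jk; rewrite leqNgt lt_psum; last by lia.
  by rewrite -leqNgt => le_j; rewrite leqNgt lt_psum // -leqNgt; lia.
have nth_n i : i < size A -> nth 0 s i < n.
  move=> lt_i; have : nth 0 s i \in s by rewrite mem_nth ?size_s.
  by case/mapP => x _ ->; apply: ltn_ord.
split.
  move=> /bounded_spreadP[_ size_A spr_A bnd_A]; rewrite spread_s in spr_A.
  apply/cappedP; split=> [|a b k]; first by rewrite mdeg_mset mul1n.
  rewrite mem_cat mul1n => /orP[]/mapP[x _ [-> -> ->]];
    apply: contraT => /window[lt_j le_j lt_nth].
    have := spread_nth spr_A (j := psum w x) (k := 1).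
    by rewrite size_s mul1n => /(_ lt_j); lia.
  have := spread_nth spr_A (j := psum w x) (k := c); rewrite size_s => /(_ lt_j).
  have := bnd_A (psum w x); rewrite -size_A => /(_ lt_j) /eqP; rewrite -/s; lia.
move=> /cappedP[deg_w caps_w]; have size_A : size A = d.
  by rewrite -mdeg_mset deg_w mul1n.
have cap1 a : a < n -> psum w (a + t) <= psum w a + 1.
  move=> lt_a; apply: (leq_trans (caps_w a (a + t) 1 _)); rewrite ?mul1n //.
  by rewrite mem_cat map_f // mem_iota.
have capc a : a < n -> psum w (a + (c * t).+1) <= psum w a + c.
  move=> lt_a; apply: (leq_trans (caps_w a (a + (c * t).+1) c _)); rewrite ?mul1n //.
  by rewrite mem_cat orbC map_f // mem_iota.
apply/bounded_spreadP; split=> //.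
  rewrite spread_s; apply/(sortedP 0) => i; rewrite size_s => lt_i.
  rewrite -[i.+1]addn1; apply: (window_nth (nth 0 s i)) => //; last by rewrite addn1.
  exact/cap1/nth_n/ltnW.
move=> j; rewrite -size_A => lt_j; rewrite -/s neq_ltn; apply/orP; right.
rewrite -addnS; apply: (window_nth (nth 0 s j)) => //; apply/capc/nth_n.
exact: leq_ltn_trans (leq_addr _ _) lt_j.
Qed.

Lemma veronese_idealE (K : fieldType) :
  ideal_eq (veronese_ideal n K c d t) (mono_ideal (capped d veronese_caps 1)).
Proof.
move=> f; split.
  apply: ideal_gen_sub; [exact: mono_ideal0|exact: mono_idealD|exact: mono_idealMl|].
  move=> _ [A bs_A ->]; rewrite mon_mset; apply: mono_idealX.
  by apply/bounded_spread_capped => //; case: bs_A.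
apply: mono_ideal_sub; [exact: ideal_gen0|exact: ideal_genD|exact: ideal_genMl|].
move=> w; have [A ms_A <-] := mset_mnm_surj w.
move=> /(bounded_spread_capped ms_A) bs_A.
by apply: ideal_gen_incl; exists A; rewrite ?mon_mset.
Qed.

End VeroneseMultisets.

Theorem corollary3p7 (K : fieldType) (n d c t : nat)
    (hn : 1 <= n) (hd : 1 <= d) (hc : 1 <= c)
    (hI : ~ ideal_eq (veronese_ideal n K c d t) zero_ideal) :
  strong_persistence (veronese_ideal n K c d t) /\
  (forall s : nat, 1 <= s ->
     has_linear_resolution (ideal_pow (veronese_ideal n K c d t) s)).
Proof.
have VE := @veronese_idealE n d c t K; split; last first.
  by move=> s _; apply: capped_linear_resolution (ideal_pow_capped VE s).
apply: (capped_strong_persistence VE).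
have [/existsP[b cap_b]|no_b] :=
  boolP [exists b : 'X_{1..n < d.+1}, capped d (veronese_caps n c t) 1 b].
  by exists b.
case: hI => f; split=> [/VE hf|->]; last exact: ideal_gen0.
apply: msuppnil0; case supp_f : (msupp f) => [//|m ms].
have [|w cap_w _] := hf m; first by rewrite supp_f mem_head.
have lt_w : mdeg w < d.+1 by have /cappedP[-> _] := cap_w; rewrite mul1n.
by case/existsP: no_b; exists (BMultinom lt_w).
Qed.
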